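(* Let $k\ge 1$ be an integer, let $\lambda_I,\lambda_E>0$ and $\mu_I,\mu_E>0$ with $\rho=\frac{\lambda_I}{k\mu_I}+\frac{\lambda_E}{k\mu_E}<1$. For every policy $\pi\in\mathcal{P}$, if the systems under $\pi$ and under Inelastic-First ($\mathrm{IF}$) start from the same state, $(N_I^{\pi}(0),N_E^{\pi}(0))=(N_I^{\mathrm{IF}}(0),N_E^{\mathrm{IF}}(0))$, then for all $t\ge0$ $$W^{\mathrm{IF}}(t)\le_{ST}W^{\pi}(t)\qquad\text{and}\qquad W_I^{\mathrm{IF}}(t)\le_{ST}W_I^{\pi}(t).$$
   Context: Model. There are $k$ identical servers, each processing work at rate $1$. Inelastic jobs arrive according to a Poisson process of rate $\lambda_I$ and elastic jobs according to an independent Poisson process of rate $\lambda_E$. Job sizes (amounts of inherent work) are independent of each other and of the arrivals, $\mathrm{Exp}(\mu_I)$ for inelastic jobs and $\mathrm{Exp}(\mu_E)$ for elastic jobs (including jobs present at time $0$, which are ordered by an arbitrary fixed arrival order within each class), and are unknown to the scheduler. Jobs are preemptible, and fractional allocations are allowed. A job allocated $n\in\mathbb{R}_{\ge0}$ servers is processed at rate $n$. An inelastic job may be allocated at most $1$ server at any time; an elastic job may be allocated any number of servers; in total at most $k$ servers are allocated. A job leaves when its remaining size is $0$. State. $N_I^\pi(t)$ and $N_E^\pi(t)$ are the numbers of inelastic and elastic jobs in the system at time $t$ under policy $\pi$; state $(i,j)$ means $i$ inelastic and $j$ elastic jobs. Allocation policies. Policies are stationary and deterministic: in each state $(i,j)\in\mathbb{Z}_{\ge0}^2$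 policy $\pi$ allocates a total of $\pi_I(i,j)\ge0$ servers to inelastic jobs and $\pi_E(i,j)\ge0$ servers to elastic jobs, with $\pi_I(i,j)\le i$, $\pi_E(i,j)\le k\mathbf{1}_{\{j>0\}}$, $\pi_I(i,j)+\pi_E(i,j)\le k$. The division within each class does not depend on the unknown sizes. Work conserving. $\pi$ is work conserving if it never leaves servers idle when there is an eligible job: $\pi_I(i,j)+\pi_E(i,j)=k$ if $j>0$, and $\pi_I(i,0)=\min(i,k)$. Class $\mathcal{P}$. A policy is in $\mathcal{P}$ if (1) it is work conserving, and (2) it serves inelastic jobs in first-come-first-served order: whenever it allocates a total of $n$ (possibly fractional) servers to inelastic jobs, the $\lfloor n\rfloor$ inelastic jobs with the earliest arrival times get one server each, and the remaining fraction of a server, if any, goes to the inelastic job with the next earliest arrival time. Elastic jobs may be served in any order. Inelastic-First ($\mathrm{IF}$): strict preemptive priority to inelastic jobs, first-come-first-served within each class. In state $(i,j)$ with $i<k$, each inelastic job gets one server and the remaining $k-i$ servers go to the elastic job with the earliest arrival time, if there is one; if $i\ge k$, the $k$ inelastic jobs with the earliest arrival times get one server each. Work. $W^\pi(t)$ is the sum of the remaining sizes of all jobs in the system at time $t$ under $\pi$; $W_I^\pi(t)$ is the sum of the remaining sizes of the inelastic jobs. For real random variables, $X\le_{ST}Y$ means $\mathbb{P}(X>x)\le\mathbb{P}(Y>x)$ for all $x\in\mathbb{R}$. *)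

(* Defs.v *)
From mathcomp Require Export all_boot all_order all_algebra.
From mathcomp Require Export finmap.
From mathcomp Require Export all_classical all_reals all_analysis.
Export Order.TTheory GRing.Theory Num.Theory.
Export numFieldNormedType.Exports.

Set Implicit Arguments.
Unset Strict Implicit.
Unset Printing Implicit Defensive.

Local Open Scope classical_set_scope.
Local Open Scope ring_scope.

(* Jobs of a class are numbered 0, 1, 2, ... in order of arrival; the jobs
   present at time 0 come first. *)
Variant job_class := Inelastic | Elastic.

Definition by_class (A : Type) (xI xE : A) (c : job_class) : A :=
  if c is Inelastic then xI else xE.

(* [p c n]: job [n] of class [c] is in the system. *)
Definition jobs_present := job_class -> nat -> bool.

Definition finitely_many (p : jobs_present) :=
  forall c, finite_set [set n | p c n].

Definition jobs_in (p : jobs_present) (c : job_class) : {fset nat} :=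
  fset_set [set n | p c n].

Definition num_jobs (p : jobs_present) (c : job_class) : nat :=
  #|` jobs_in p c|.

(* Number of present jobs of class [c] that arrived before job [n]. *)
Definition num_earlier (p : jobs_present) (c : job_class) (n : nat) : nat :=
  (\sum_(m < n) p c m)%N.

Section Policies.
Variable R : realType.

(* What a scheduler that does not know the job sizes can observe: which jobs
   are in the system at each time. *)
Definition history := R -> jobs_present.

(* The history up to time [t] only (frozen after [t]). *)
Definition history_until (t : R) (h : history) : history :=
  fun s => h (Num.min s t).

(* [alloc c i j] is the number of servers given to class [c] in state [(i, j)].
   [division t h c n] is the number of servers given to job [n] of class [c] at
   time [t] when the history up to [t] is [h]; this is the only way in which
   the past may be used, and the job sizes are not an argument. *)
Record policy := Policy {
  alloc : job_class -> nat -> nat -> R;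
  division : R -> history -> job_class -> nat -> R }.

Definition feasible (k : nat) (pi : policy) : Prop :=
  (forall i j,
     [/\ 0 <= alloc pi Inelastic i j, 0 <= alloc pi Elastic i j,
         alloc pi Inelastic i j <= i%:R,
         alloc pi Elastic i j <= (if (0 < j)%N then k%:R else 0) &
         alloc pi Inelastic i j + alloc pi Elastic i j <= k%:R]) /\
  (forall (t : R) (h : history), finitely_many (h t) ->
     [/\ forall c n, 0 <= division pi t h c n,
         forall c n, ~~ h t c n -> division pi t h c n = 0,
         forall n, division pi t h Inelastic n <= 1 &
         forall c, \sum_(n <- jobs_in (h t) c) division pi t h c n =
           alloc pi c (num_jobs (h t) Inelastic) (num_jobs (h t) Elastic)]).

Definition work_conserving (k : nat) (pi : policy) : Prop :=
  (forall i j, (0 < j)%N ->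
     alloc pi Inelastic i j + alloc pi Elastic i j = k%:R) /\
  (forall i, alloc pi Inelastic i 0%N = (minn i k)%:R).

(* Share of the job with [r] earlier jobs of its class present, when [x] servers
   are divided in FCFS order with at most one server per job. *)
Definition fcfs_share (x : R) (r : nat) : R :=
  if (r < Num.truncn x)%N then 1
  else if r == Num.truncn x then x - (Num.truncn x)%:R
  else 0.

Definition inelastic_fcfs (pi : policy) : Prop :=
  forall (t : R) (h : history) (n : nat), finitely_many (h t) ->
    h t Inelastic n ->
    division pi t h Inelastic n =
      fcfs_share
        (alloc pi Inelastic (num_jobs (h t) Inelastic) (num_jobs (h t) Elastic))
        (num_earlier (h t) Inelastic n).

Definition class_P (k : nat) (pi : policy) : Prop :=
  [/\ feasible k pi, work_conserving k pi & inelastic_fcfs pi].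

Definition IF_alloc (k : nat) (c : job_class) (i j : nat) : R :=
  if c is Inelastic then (minn i k)%:R
  else if (0 < j)%N then (k - minn i k)%:R else 0.

Definition IF_division (k : nat) (t : R) (h : history) (c : job_class)
    (n : nat) : R :=
  if h t c n then
    if c is Inelastic then
      if (num_earlier (h t) Inelastic n < k)%N then 1 else 0
    else
      if num_earlier (h t) Elastic n == 0%N
      then (k - minn (num_jobs (h t) Inelastic) k)%:R else 0
  else 0.

Definition IF (k : nat) : policy := Policy (IF_alloc k) (IF_division k).

End Policies.

Section SamplePaths.
Variable R : realType.

(* Arrival times: the [n0 c] initial jobs arrive at time 0, and the job [n0 c + m]
   arrives at the [(m+1)]-st epoch of the renewal process with the given gaps. *)
Definition arrival_time (n0 : job_class -> nat) (gap : job_class -> nat -> R)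
    (c : job_class) (n : nat) : R :=
  \sum_(m < n.+1 - n0 c) gap c m.

(* [rem c n t] is the remaining size at time [t] of job [n] of class [c]; it is
   the full size before the job arrives. *)
Definition path_history (arr : job_class -> nat -> R)
    (rem : job_class -> nat -> R -> R) : history R :=
  fun t c n => (arr c n <= t) && (0 < rem c n t).

Definition path_rate (pi : policy R) (arr : job_class -> nat -> R)
    (rem : job_class -> nat -> R -> R) (c : job_class) (n : nat) (t : R) : R :=
  division pi t (history_until t (path_history arr rem)) c n.

Definition is_sample_path (pi : policy R) (arr : job_class -> nat -> R)
    (size : job_class -> nat -> R) (rem : job_class -> nat -> R -> R) : Prop :=
  forall c n (t : R), 0 <= t ->
    lebesgue_measure.-integrable `[0, t]
      (EFin \o path_rate pi arr rem c n) /\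
    rem c n t =
      size c n - \int[lebesgue_measure]_(s in `[0, t]) path_rate pi arr rem c n s.

End SamplePaths.

Section Systems.
Context {R : realType} {d : measure_display} {T : measurableType d}.
Variable P : probability T R.

Definition mutually_independent (I : Type) (X : I -> {RV P >-> R}) : Prop :=
  forall (m : nat) (f : 'I_m -> I) (B : 'I_m -> set R),
    injective f -> (forall i, measurable (B i)) ->
    P (\bigcap_(i in [set: 'I_m]) (X (f i) @^-1` B i)) =
      (\prod_(i < m) P (X (f i) @^-1` B i))%E.

Definition exponentially_distributed (X : {RV P >-> R}) (r : R) : Prop :=
  forall A : set R, measurable A -> distribution P X A = exponential_prob r A.

Record system := System {
  gap : job_class -> nat -> {RV P >-> R};
  size : job_class -> nat -> {RV P >-> R};
  remaining : job_class -> nat -> R -> {RV P >-> R} }.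

(* Interarrival times and sizes, as a single family. *)
Definition primitives (S : system)
    (a : (job_class * nat) + (job_class * nat)) : {RV P >-> R} :=
  match a with
  | inl (c, n) => gap S c n
  | inr (c, n) => size S c n
  end.

Definition arrival (n0 : job_class -> nat) (S : system) (w : T) :
    job_class -> nat -> R :=
  arrival_time n0 (fun c n => gap S c n w).

(* [S] is the system run by [pi] from state [(n0 Inelastic, n0 Elastic)]: the
   interarrival times of class [c] are Exp([lambda c]), i.e. its arrivals form
   a Poisson process of that rate, and the sizes are Exp([mu c]). *)
Definition is_system (lambda mu : job_class -> R) (n0 : job_class -> nat)
    (pi : policy R) (S : system) : Prop :=
  [/\ forall c n, exponentially_distributed (gap S c n) (lambda c),
      forall c n, exponentially_distributed (size S c n) (mu c),
      mutually_independent (primitives S) &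
      {ae P, forall w, is_sample_path pi (arrival n0 S w)
        (fun c n => size S c n w) (fun c n t => remaining S c n t w)}].

(* Extended-real valued because the sum is over all jobs; it is finite almost
   surely, since almost surely finitely many jobs have arrived by time [t]. *)
Definition class_work (n0 : job_class -> nat) (S : system) (c : job_class)
    (t : R) (w : T) : \bar R :=
  (\sum_(0 <= n <oo)
     if path_history (arrival n0 S w) (fun c n s => remaining S c n s w) t c n
     then (remaining S c n t w)%:E else 0)%E.

Definition total_work (n0 : job_class -> nat) (S : system) (t : R) (w : T) :
    \bar R :=
  (class_work n0 S Inelastic t w + class_work n0 S Elastic t w)%E.

End Systems.

(* The two variables may live on different probability spaces. *)
Definition st_le {R : realType} {d1 d2 : measure_display}
    {T1 : measurableType d1} {T2 : measurableType d2}
    (P1 : probability T1 R) (P2 : probability T2 R)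
    (X : T1 -> \bar R) (Y : T2 -> \bar R) : Prop :=
  forall x : R,
    (P1 [set w | x%:E < X w] <= P2 [set w | x%:E < Y w])%E.

(* Main.v *)
(** The Inelastic-First system can be compared with any policy of the class on
    one set of arrival times and job sizes, through explicit functionals of
    these data.

    Let [D n] be the completion times of the FCFS queue with [k] servers fed by
    the inelastic jobs alone.  Under a policy of the class, an inelastic job is
    served at rate at most [1] and only while fewer than [k] earlier inelastic
    jobs are present, so by induction it never has less work left than in this
    queue; under Inelastic-First it has exactly as much.  For the total work,
    let [u <= t] be the arrival time of the [m]-th elastic job.  The jobs of the
    [k]-server queue at [u], together with the elastic jobs numbered from [m] on,
    bring an amount of work of which at most [k * (t - u)] is done by time [t];
    this bounds the total work at [t] from below.  Under Inelastic-First the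
    bound is attained when [u] starts the elastic busy period containing [t],
    since then all servers are busy during [[u, t]]; and if no elastic job is
    present at [t], the total work is the inelastic work.

    Both comparisons hold almost surely, each on its own probability space.  The
    bounding functionals are measurable, and the primitives of the two systems
    have the same law, as independence determines it on a pi-system. *)
Require Import Defs.
From HB Require Import structures.
From mathcomp Require Import measurable_realfun lra zify.

Set Implicit Arguments.
Unset Strict Implicit.
Unset Printing Implicit Defensive.

Local Open Scope classical_set_scope.
Local Open Scope ring_scope.

(** * The FCFS queue with [k] servers *)

Section FcfsQueue.
Variables (R : realType) (k : nat) (a z : nat -> R).

(* The [k]-th largest of the completion times [D 0], ..., [D n.-1], or [a n] if
   that is larger (in particular if [n < k]). *)
Definition start_after (D : nat -> R) (n : nat) : R :=
  \big[Num.max/a n]_(i < n)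
    (if (k <= \sum_(j < n) (D i <= D j)%R)%N then D i else a n).

(** Course-of-values recursion by iteration: each round recomputes the whole sequence from the
    previous one, and the value at [n] is final after [n.+1] rounds, whatever the initial
    sequence. *)
Definition completion (n : nat) : R :=
  iter n.+1 (fun D m => start_after D m + z m) (fun=> 0) n.

Definition fcfs_start (n : nat) : R := start_after completion n.

(** For a positive size, this is [z n] until [fcfs_start n], then falls at rate 1 until it reaches
    0. *)
Definition fcfs_rem (n : nat) (t : R) : R :=
  Num.max 0 (Num.min (z n) (completion n - t)).

Lemma eq_start_after (D D' : nat -> R) n :
  (forall m, (m < n)%N -> D m = D' m) -> start_after D n = start_after D' n.
Proof.
move=> DD'; apply: eq_bigr => i _; rewrite DD'//.
congr (if (k <= _)%N then _ else _).
by apply: eq_bigr => j _; rewrite DD'.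
Qed.

Lemma completionE n : completion n = fcfs_start n + z n.
Proof.
(* A round reads only indices below [m] to compute the value at [m], and by induction these were
   already final. *)
have stable m j : (m < j)%N ->
    iter j (fun D m => start_after D m + z m) (fun=> 0) m = completion m.
  elim/ltn_ind: m j => m IH [//|j] mj; rewrite /completion !iterS.
  congr (_ + _); apply: eq_start_after => l lm.
  by rewrite !IH//; lia.
rewrite {1}/completion iterS; congr (_ + _); apply: eq_start_after => m mn.
exact: stable.
Qed.

Lemma arrival_le_start n : a n <= fcfs_start n.
Proof. by apply: bigmax_ge_id. Qed.

(** As [s] is not below the default [a n], it lies below a completion time retained in the maximum,
    and at least [k] completion times are no smaller than that one. *)
Lemma lt_start_busy n s : a n <= s -> s < fcfs_start n ->
  (k <= \sum_(m < n) (s < completion m)%R)%N.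
Proof.
move=> ans /bigmax_gtP[|[i _]]; first by rewrite ltNge ans.
case: ifPn => [ki|_]; last by rewrite ltNge ans.
move=> si; apply: leq_trans ki _; apply: leq_sum => j _.
by case: (leP (completion i)) => //= /(lt_le_trans si) ->.
Qed.

(** If [k] earlier completions came after [s], the first of them would have at least [k] completion
    times no smaller than itself, hence enter the maximum and push [fcfs_start n] beyond [s]. *)
Lemma start_le_idle n s : (0 < k)%N -> fcfs_start n <= s ->
  (\sum_(m < n) (s < completion m)%R < k)%N.
Proof.
move=> k_gt0 Ss; rewrite ltnNge; apply/negP => ks.
have /existsP[i0 i0P] : [exists i : 'I_n, s < completion i].
  apply: contraLR ks => /existsPn none; rewrite -ltnNge big1// => m _.
  by rewrite (negbTE (none m)).
pose i := [arg min_(j < i0 | s < completion j) completion j]%O.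
have [si imin] : s < completion i /\
    forall j : 'I_n, s < completion j -> completion i <= completion j.
  by rewrite /i; case: arg_minP => // j sj jmin; split.
suff : completion i <= fcfs_start n by rewrite leNgt (le_lt_trans Ss).
apply: (@bigmax_sup _ _ _ _ i) => //; rewrite ifT//.
apply: leq_trans ks _; apply: leq_sum => j _.
by case: (ltP s) => // /imin ->.
Qed.

Lemma fcfs_rem_ge0 n t : 0 <= fcfs_rem n t.
Proof. by rewrite /fcfs_rem le_max lexx. Qed.

End FcfsQueue.

(** * Counting present jobs *)

Lemma mem_jobs_in (p : jobs_present) (c : job_class) (n : nat) :
  finitely_many p -> (n \in jobs_in p c) = p c n.
Proof.
move=> fp; rewrite in_fset_set; last exact: fp.
by apply/idP/idP => [/set_mem|?]; [|apply/mem_set].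
Qed.

Lemma sum_jobs_in (V : nmodType) (p : jobs_present) (c : job_class) (N : nat)
    (f : nat -> V) : finitely_many p -> (forall n, p c n -> (n < N)%N) ->
  \sum_(n <- jobs_in p c) f n = \sum_(n < N | p c n) f n.
Proof.
move=> fp pN; rewrite -(big_mkord (p c) f) /index_iota subn0 -big_filter.
apply: perm_big; apply: uniq_perm; rewrite ?filter_uniq ?iota_uniq//.
move=> n; rewrite mem_filter mem_iota /= add0n -(mem_jobs_in c n fp).
by case: (boolP (n \in jobs_in p c)) => //; rewrite mem_jobs_in// => /pN ->.
Qed.

Lemma num_jobsE (p : jobs_present) (c : job_class) (N : nat) :
  finitely_many p -> (forall n, p c n -> (n < N)%N) ->
  num_jobs p c = (\sum_(n < N) p c n)%N.
Proof.
move=> fp pN; rewrite /num_jobs -sum1_size (sum_jobs_in (fun=> 1%N) fp pN).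
by rewrite big_mkcond; apply: eq_bigr => i _; case: (p c i).
Qed.

Lemma finitely_many_bounded (p : jobs_present) (c : job_class) :
  finitely_many p -> exists N, forall n, p c n -> (n < N)%N.
Proof.
move=> fp; exists (\sum_(n <- jobs_in p c) n.+1)%N => n pn.
rewrite (big_rem n) /=; last by rewrite mem_jobs_in.
exact: leq_addr.
Qed.

(** Induction on [N]: a present job [N] adds one to the left exactly when fewer than [k] present
    jobs precede it, which is when the minimum grows. *)
Lemma sum_earliest_bounded (p : pred nat) (k N : nat) :
  (\sum_(n < N | p n) (\sum_(m < n) p m < k))%N = minn (\sum_(n < N) p n) k.
Proof.
rewrite big_mkcond; elim: N => [|N IH]; first by rewrite !big_ord0 min0n.
rewrite big_ord_recr [in RHS]big_ord_recr /= IH.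
by case: (p N) => /=; case: ltnP => /=; lia.
Qed.

Lemma sum_earliest (p : jobs_present) (c : job_class) (k : nat) :
  finitely_many p ->
  (\sum_(n <- jobs_in p c) (num_earlier p c n < k))%N = minn (num_jobs p c) k.
Proof.
move=> fp; have [N pN] := finitely_many_bounded c fp.
by rewrite (sum_jobs_in _ fp pN) (num_jobsE fp pN) sum_earliest_bounded.
Qed.

Lemma IF_division_inelastic (R : realType) (k : nat) (t : R) (h : history R)
    (n : nat) : h t Inelastic n ->
  division (IF R k) t h Inelastic n = (num_earlier (h t) Inelastic n < k)%:R.
Proof. by move=> hn; rewrite /= /IF_division hn; case: ifP. Qed.

Lemma IF_feasible (R : realType) (k : nat) : feasible k (IF R k).
Proof.
split=> [i j|t h fh]; first split.
- by rewrite /= ler0n.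
- by rewrite /=; case: ifP.
- by rewrite /= ler_nat geq_minl.
- by rewrite /=; case: ifP => // _; rewrite ler_nat leq_subr.
- rewrite /=; case: ifP => _; last by rewrite addr0 ler_nat geq_minr.
  by rewrite -natrD ler_nat subnKC// geq_minr.
split.
- move=> c n; rewrite /= /IF_division; case: ifP => // _.
  by case: c; case: ifP => //; rewrite ler0n.
- by move=> c n /negbTE hn; rewrite /= /IF_division hn.
- move=> n; rewrite /= /IF_division; case: ifP => // _.
  by case: ifP => //; rewrite ler01.
case.
- rewrite /= -sum_earliest// natr_sum; apply: eq_big_seq => n.
  by rewrite mem_jobs_in// => hn; exact: IF_division_inelastic.
- rewrite /=; set a := (k - _)%:R.
  (* Serving only the earliest elastic job is the case of threshold 1, so that [sum_earliest]
     applies again. *)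
  transitivity (\sum_(n <- jobs_in (h t) Elastic)
    a *+ (num_earlier (h t) Elastic n < 1)%N).
    apply: eq_big_seq => n; rewrite mem_jobs_in// => hn.
    by rewrite /IF_division hn ltnS leqn0; case: eqP => // _; rewrite mulr1n.
  by rewrite sumrMnr sum_earliest// /minn; case: num_jobs => [|[|n]].
Qed.

Lemma IF_work_conserving (R : realType) (k : nat) : work_conserving k (IF R k).
Proof.
by split=> // i j j0 /=; rewrite j0 -natrD subnKC// geq_minr.
Qed.

(** * Sample paths *)

Section FiniteSums.
Context {d : measure_display} {T : measurableType d} {R : realType}.
Variable mu : {measure set T -> \bar R}.

Lemma integrable_Rsum (I : Type) (D : set T) (r : seq I) (f : I -> T -> R) :
  measurable D -> (forall i, mu.-integrable D (EFin \o f i)) ->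
  mu.-integrable D (EFin \o (fun x => \sum_(i <- r) f i x)).
Proof.
move=> mD intf; elim: r => [|i r IH].
  by under eq_fun do rewrite big_nil; exact: integrable0.
under eq_fun do rewrite big_cons.
exact: (integrableD mD (intf i) IH).
Qed.

Lemma Rintegral_sum (I : Type) (D : set T) (r : seq I) (f : I -> T -> R) :
  measurable D -> (forall i, mu.-integrable D (EFin \o f i)) ->
  \int[mu]_(x in D) (\sum_(i <- r) f i x) =
  \sum_(i <- r) \int[mu]_(x in D) f i x.
Proof.
move=> mD intf; elim: r => [|i r IH].
  under eq_Rintegral do rewrite big_nil.
  by rewrite big_nil Rintegral_cst// mul0r.
under eq_Rintegral do rewrite big_cons.
by rewrite big_cons RintegralD ?IH//; exact: integrable_Rsum.
Qed.

End FiniteSums.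

Section Constants.
Variable R : realType.
Local Notation mu := (@lebesgue_measure R).

Lemma Rintegral_itvoo_cst (u t K : R) : u <= t ->
  \int[mu]_(_ in `]u, t[) K = K * (t - u).
Proof.
move=> ut; rewrite Rintegral_cst//; congr *%R.
have := lebesgue_measure_itv `]u, t[; rewrite /= lte_fin => ->.
by case: ltgtP ut => //= -> _; rewrite subrr.
Qed.

Lemma integrable_itvoo_cst (u t K : R) : mu.-integrable `]u, t[ (EFin \o cst K).
Proof.
have int_cc : mu.-integrable `[u, t] (EFin \o cst K).
  apply: continuous_compact_integrable; first exact: segment_compact.
  by apply: continuous_subspaceT => x; exact: cst_continuous.
by apply: (integrableS _ _ _ int_cc) => //; exact: subset_itv_oo_cc.
Qed.

End Constants.

(** * Work functionals as series, and their reduction to finite sums *)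

Section Work.
Context {R : realType}.

(** Two times occur because the bound counts the jobs arrived by [t] but their work at a time [u]
    that may be earlier. *)
Definition fcfs_work (k : nat) (a z : nat -> R) (t u : R) : \bar R :=
  (\sum_(0 <= n <oo) if (a n <= t)%R then (fcfs_rem k a z n u)%:E else 0)%E.

(* The absolute value only serves to have a series of nonnegative terms, hence a
   measurable function, for all families of sizes: almost surely [z n] is
   positive. *)
Definition late_work (a z : nat -> R) (m : nat) (t : R) : \bar R :=
  (\sum_(0 <= n <oo) if (m <= n)%N && (a n <= t)%R then `|z n|%:E else 0)%E.

Definition work_bound (k : nat) (aI zI aE zE : nat -> R) (m : nat) (t : R) :
    \bar R :=
  (fcfs_work k aI zI t (aE m) + late_work aE zE m t
   - (k%:R * (t - aE m))%:E)%E.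

Lemma eseries_finite (f : nat -> \bar R) (N : nat) :
  (forall n, (N <= n)%N -> f n = 0%E) ->
  (\sum_(0 <= n <oo) f n = \sum_(n < N) f n)%E.
Proof.
move=> f0; apply: lim_near_cst => //; near=> n.
have Nn : (N <= n)%N by near: n; exact: nbhs_infty_ge.
rewrite -(big_mkord xpredT) (big_cat_nat (leq0n N) Nn)//=.
rewrite [X in (_ + X)%E]big_nat_cond.
by rewrite [X in (_ + X)%E]big1 ?adde0// => i /andP[/andP[/f0]].
Unshelve. all: by end_near. Qed.

Lemma eseries_cond_finite (p : pred nat) (g : nat -> R) (N : nat) :
  (forall n, p n -> (n < N)%N) ->
  (\sum_(0 <= n <oo) (if p n then (g n)%:E else 0))%E =
  (\sum_(n < N | p n) g n)%:E.
Proof.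
move=> pN; rewrite (@eseries_finite _ N); last first.
  by move=> n Nn; case: ifP => // /pN; rewrite ltnNge Nn.
by rewrite -sumEFin [RHS]big_mkcond.
Qed.

End Work.

(** * Service and remaining sizes along one sample path *)

Section SamplePath.
Variables (R : realType) (k : nat) (pi : policy R).
Variables (arr size : job_class -> nat -> R) (rem : job_class -> nat -> R -> R).
Hypothesis pi_feasible : feasible k pi.
Hypothesis arr_ge0 : forall c n, 0 <= arr c n.
Hypothesis arr_locally_finite :
  forall t, exists N, forall c n, arr c n <= t -> (n < N)%N.
Hypothesis rem_path : is_sample_path pi arr size rem.

Local Notation present := (path_history arr rem).
Local Notation rate := (path_rate pi arr rem).
Local Notation state_alloc c t :=
  (alloc pi c (num_jobs (present t) Inelastic) (num_jobs (present t) Elastic)).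

Lemma history_until_now (t : R) (h : history R) : history_until t h t = h t.
Proof. by rewrite /history_until minxx. Qed.

Lemma present_finite t : finitely_many (present t).
Proof.
move=> c; have [N arrN] := arr_locally_finite t.
apply: (sub_finite_set _ (finite_II N)) => n /= /andP[/arrN + _].
exact.
Qed.

Lemma present_until_finite t : finitely_many (history_until t present t).
Proof. by rewrite history_until_now; exact: present_finite. Qed.

Lemma rate_ge0 c n t : 0 <= rate c n t.
Proof.
by have [+ _ _ _] := pi_feasible.2 t _ (present_until_finite t); exact.
Qed.

Lemma rate_absent c n t : ~~ present t c n -> rate c n t = 0.
Proof.
have [_ + _ _] := pi_feasible.2 t _ (present_until_finite t).
by move=> /(_ c n); rewrite history_until_now.
Qed.

Lemma rate_inelastic_le1 n t : rate Inelastic n t <= 1.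
Proof.
by have [_ _ + _] := pi_feasible.2 t _ (present_until_finite t); exact.
Qed.

Lemma sum_rate c t N : (forall n, arr c n <= t -> (n < N)%N) ->
  \sum_(n < N) rate c n t = state_alloc c t.
Proof.
move=> arrN.
have [_ _ _ +] := pi_feasible.2 t _ (present_until_finite t).
move=> /(_ c); rewrite history_until_now => <-.
rewrite (@sum_jobs_in _ _ _ N); last 2 first.
- exact: present_finite.
- by move=> n /andP[/arrN].
rewrite [RHS]big_mkcond; apply: eq_bigr => n _.
by case: ifPn => // /rate_absent.
Qed.

Lemma state_alloc_le t :
  state_alloc Inelastic t + state_alloc Elastic t <= k%:R.
Proof.
by have [] := pi_feasible.1 (num_jobs (present t) Inelastic)
  (num_jobs (present t) Elastic).
Qed.

Lemma state_alloc_ge0 c t : 0 <= state_alloc c t.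
Proof.
by have [] := pi_feasible.1 (num_jobs (present t) Inelastic)
  (num_jobs (present t) Elastic); case: c.
Qed.

Lemma rate_le c n t : rate c n t <= k%:R.
Proof.
case: (boolP (present t c n)) => [ptn|/rate_absent ->]; last by rewrite ler0n.
have [N arrN] := arr_locally_finite t.
have nN : (n < N)%N by apply: (arrN c); case/andP: ptn.
apply: (@le_trans _ _ (state_alloc c t)).
  rewrite -(sum_rate (arrN c)) (bigD1 (Ordinal nN)) //= lerDl sumr_ge0//.
  by move=> i _; exact: rate_ge0.
apply: le_trans (state_alloc_le t).
by case: (c); rewrite ?lerDl ?lerDr state_alloc_ge0.
Qed.

Lemma rate_integrable c n u t : 0 <= u ->
  lebesgue_measure.-integrable `]u, t[ (EFin \o rate c n).
Proof.
move=> u0; have [t0|t0] := leP 0 t.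
  have [+ _] := rem_path c n t0; apply: integrableS => //.
  apply: subset_itv; rewrite bnd_simp//.
by rewrite set_itv_ge ?integrable_set0// bnd_simp -leNgt (le_trans (ltW t0)).
Qed.

(** The endpoints are null, and leaving them out means that later bounds on rates are only required
    strictly between [u] and [t]. *)
Lemma rem_decrement c n u t : 0 <= u -> u <= t ->
  rem c n u - rem c n t = \int[lebesgue_measure]_(s in `]u, t[) rate c n s.
Proof.
move=> u0 ut; have t0 := le_trans u0 ut.
have [int_t ->] := rem_path c n t0; have [_ ->] := rem_path c n u0.
rewrite Rintegral_itv_bndo_bndc; last exact: rate_integrable.
by rewrite -(Rintegral_itvB int_t) ?bnd_simp//; lra.
Qed.

Lemma sum_rem_decrement (r : seq (job_class * nat)) u t : 0 <= u -> u <= t ->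
  \sum_(j <- r) (rem j.1 j.2 u - rem j.1 j.2 t) =
  \int[lebesgue_measure]_(s in `]u, t[) (\sum_(j <- r) rate j.1 j.2 s).
Proof.
move=> u0 ut; rewrite Rintegral_sum//; last by move=> j; exact: rate_integrable.
by apply: eq_bigr => j _; exact: rem_decrement.
Qed.

Lemma sum_rem_decrement_le (r : seq (job_class * nat)) (K u t : R) :
  0 <= u -> u <= t ->
  (forall s, u < s -> s < t -> \sum_(j <- r) rate j.1 j.2 s <= K) ->
  \sum_(j <- r) (rem j.1 j.2 u - rem j.1 j.2 t) <= K * (t - u).
Proof.
move=> u0 ut rateK; rewrite sum_rem_decrement// -Rintegral_itvoo_cst//.
apply: le_Rintegral => //.
- by apply: integrable_Rsum => // j; exact: rate_integrable.
- exact: integrable_itvoo_cst.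
- by move=> s /=; rewrite in_itv/= => /andP[us st]; exact: rateK.
Qed.

Lemma sum_rem_decrement_ge (r : seq (job_class * nat)) (K u t : R) :
  0 <= u -> u <= t ->
  (forall s, u < s -> s < t -> K <= \sum_(j <- r) rate j.1 j.2 s) ->
  K * (t - u) <= \sum_(j <- r) (rem j.1 j.2 u - rem j.1 j.2 t).
Proof.
move=> u0 ut rateK; rewrite sum_rem_decrement// -Rintegral_itvoo_cst//.
apply: le_Rintegral => //.
- exact: integrable_itvoo_cst.
- by apply: integrable_Rsum => // j; exact: rate_integrable.
- by move=> s /=; rewrite in_itv/= => /andP[us st]; exact: rateK.
Qed.

Lemma rem_decrement_le c n (K u t : R) : 0 <= u -> u <= t ->
  (forall s, u < s -> s < t -> rate c n s <= K) ->
  rem c n u - rem c n t <= K * (t - u).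
Proof.
move=> u0 ut rateK; have := @sum_rem_decrement_le [:: (c, n)] K u t u0 ut.
by rewrite big_seq1; apply=> s us st; rewrite big_seq1 /=; exact: rateK.
Qed.

Lemma rem_decrement_ge c n (K u t : R) : 0 <= u -> u <= t ->
  (forall s, u < s -> s < t -> K <= rate c n s) ->
  K * (t - u) <= rem c n u - rem c n t.
Proof.
move=> u0 ut rateK; have := @sum_rem_decrement_ge [:: (c, n)] K u t u0 ut.
by rewrite big_seq1; apply=> s us st; rewrite big_seq1 /=; exact: rateK.
Qed.

Lemma rem_nonincreasing c n u t : 0 <= u -> u <= t -> rem c n t <= rem c n u.
Proof.
move=> u0 ut; have := @rem_decrement_ge c n 0 u t u0 ut.
by rewrite mul0r subr_ge0; apply=> s _ _; exact: rate_ge0.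
Qed.

Lemma rem0 c n : rem c n 0 = size c n.
Proof.
by have [_ ->] := rem_path c n (lexx 0); rewrite set_itv1 Rintegral_set1 subr0.
Qed.

Lemma rem_le_size c n t : 0 <= t -> rem c n t <= size c n.
Proof. by move=> t0; rewrite -rem0; exact: rem_nonincreasing. Qed.

Lemma rem_before_arrival c n t : 0 <= t -> t <= arr c n ->
  rem c n t = size c n.
Proof.
move=> t0 ta; apply/eqP; rewrite eq_le rem_le_size//= -rem0.
have := @rem_decrement_le c n 0 0 t (lexx 0) t0.
rewrite mul0r subr_le0; apply=> s _ st.
by rewrite rate_absent// /path_history negb_and -ltNge (lt_le_trans st).
Qed.

(* A job is processed at rate at most [k] and only while its remaining size is
   positive, so it cannot overshoot [0]. *)
Lemma rem_ge0 c n t : 0 < size c n -> 0 <= t -> 0 <= rem c n t.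
Proof.
move=> size0 t0; rewrite leNgt; apply/negP => remt.
pose A := [set s | 0 <= s <= t /\ 0 < rem c n s].
have A0 : A 0 by split; [rewrite lexx|rewrite rem0].
have At : has_ubound A by exists t => s [/andP[]].
have supA : has_sup A by split; [exists 0|].
(* With this choice the deficit [- rem c n t] is [(k%:R + 1) * e], more than the [k%:R * e] that can
   be lost within time [e]. *)
pose e := - rem c n t / (k%:R + 1).
have e0 : 0 < e by rewrite divr_gt0 ?oppr_gt0// ltr_wpDl.
have [s [/andP[s0 st] rems] es] := sup_adherent e0 supA.
have ut : sup A <= t by apply: ge_sup; [exists 0|move=> v [/andP[]]].
have su : s <= sup A by apply: ub_le_sup => //; split => //; rewrite s0.
have u0 := le_trans s0 su.
have d1 := @rem_decrement_le c n k%:R s (sup A) s0 su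
  (fun v _ _ => rate_le c n v).
(* After the last times with positive remaining size the job is absent, so nothing more is lost. *)
have d2 : rem c n (sup A) - rem c n t <= 0 * (t - sup A).
  apply: rem_decrement_le => // v uv vt.
  rewrite rate_absent// /path_history negb_and orbC -leNgt.
  rewrite leNgt; apply/orP; left; apply/negP => remv.
  suff : v <= sup A by rewrite leNgt uv.
  apply: ub_le_sup => //; split => //.
  by rewrite (ltW vt) (le_trans u0 (ltW uv)).
have : (k%:R + 1) * e = - rem c n t by rewrite mulrC divfK// gt_eqF// ltr_wpDl.
have : k%:R * (sup A - s) <= k%:R * e by rewrite ler_wpM2l//; lra.
by lra.
Qed.


(** * Comparison of the inelastic jobs with the FCFS queue *)

Hypothesis k_gt0 : (0 < k)%N.
Hypothesis arr_mono : forall c m n, (m <= n)%N -> arr c m <= arr c n.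
Hypothesis size_gt0 : forall c n, 0 < size c n.

Local Notation IF_completion := (completion k (arr Inelastic) (size Inelastic)).
Local Notation IF_start := (fcfs_start k (arr Inelastic) (size Inelastic)).
Local Notation IF_rem := (fcfs_rem k (arr Inelastic) (size Inelastic)).

(** At most [k] servers are shared out, so only ranks below [k] can get a positive share. The
    delicate rank is [Num.truncn x]: if it is at least [k], then [x] is an integer and the leftover
    fraction is 0. *)
Lemma rate_busy n t : inelastic_fcfs pi ->
  (k <= num_earlier (present t) Inelastic n)%N -> rate Inelastic n t = 0.
Proof.
move=> fcfs kn; case: (boolP (present t Inelastic n)); last exact: rate_absent.
move=> tn; rewrite /path_rate fcfs ?history_until_now//; last first.
  exact: present_finite.
have [x0 _ _ _ _] := pi_feasible.1 (num_jobs (present t) Inelastic)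
  (num_jobs (present t) Elastic).
have := state_alloc_le t; have := state_alloc_ge0 Elastic t.
move: x0; set x := alloc _ _ _ _ => x0 E0 xk.
have {E0 xk} xk : x <= k%:R by apply: le_trans xk; rewrite lerDl.
have /andP[trunc_le trunc_gt] := truncn_itv x0.
have tk : (Num.truncn x <= k)%N by rewrite -(ler_nat R) (le_trans trunc_le).
rewrite /fcfs_share ltnNge (leq_trans tk kn) /=; case: eqP => // nx.
by apply/eqP; rewrite subr_eq0 eq_le trunc_le andbT (le_trans xk)// ler_nat -nx.
Qed.

(* By induction, the jobs before [n] leave no earlier than in the
   Inelastic-First queue, so job [n] gets no service before [IF_start n]. *)
Lemma rem_ge_completion n t : inelastic_fcfs pi -> 0 <= t ->
  Num.min (size Inelastic n) (IF_completion n - t) <= rem Inelastic n t.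
Proof.
move=> fcfs; elim/ltn_ind: n t => n IH t t0.
have S0 : 0 <= IF_start n by apply: le_trans (arrival_le_start _ _ _ _).
have no_service s : 0 <= s -> s < IF_start n -> rate Inelastic n s = 0.
  move=> s0 sS; have [sa|an_s] := ltP s (arr Inelastic n).
    by rewrite rate_absent// /path_history negb_and -ltNge sa.
  apply: rate_busy => //; apply: leq_trans (lt_start_busy an_s sS) _.
  apply: leq_sum => m _; case: (ltP s) => //= sm.
  rewrite /path_history (le_trans (arr_mono _ (ltnW (ltn_ord m))))//=.
  by rewrite (lt_le_trans _ (IH m (ltn_ord m) s s0))// lt_min size_gt0 subr_gt0.
have size_left v : 0 <= v -> v <= IF_start n ->
    size Inelastic n <= rem Inelastic n v.
  move=> v0 vS; rewrite -rem0 -subr_le0.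
  have := @rem_decrement_le Inelastic n 0 0 v (lexx 0) v0.
  rewrite mul0r; apply=> s s0 sv.
  by rewrite no_service// ?ltW// (lt_le_trans sv).
have [tS|/ltW St] := leP t (IF_start n).
  by rewrite ge_min size_left.
have := @rem_decrement_le Inelastic n 1 _ t S0 St
  (fun s _ _ => rate_inelastic_le1 n s).
have := size_left _ S0 (lexx _).
rewrite ge_min completionE => ? ?; apply/orP; right; lra.
Qed.

Lemma fcfs_rem_le_rem n t : inelastic_fcfs pi -> 0 <= t ->
  IF_rem n t <= rem Inelastic n t.
Proof.
by move=> fcfs t0; rewrite /fcfs_rem ge_max rem_ge0// rem_ge_completion.
Qed.

(** By induction the earlier jobs have no more left than in the queue, so from [IF_start n] on fewer
    than [k] of them are present and job [n] holds a full server. *)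
Lemma rem_le_fcfs_rem n t :
  (forall m s, present s Inelastic m ->
    (num_earlier (present s) Inelastic m < k)%N -> rate Inelastic m s = 1) ->
  0 <= t -> rem Inelastic n t <= IF_rem n t.
Proof.
move=> full; elim/ltn_ind: n t => n IH t t0.
have S0 : 0 <= IF_start n by apply: le_trans (arrival_le_start _ _ _ _).
have [tS|/ltW St] := leP t (IF_start n).
  rewrite /fcfs_rem le_max le_min rem_le_size// completionE.
  have := rem_le_size Inelastic n t0 => ?.
  by apply/orP; right; lra.
(* With nothing left the bound is trivial; otherwise the job is present from its start up to [t], as
   remaining sizes do not increase. *)
have [rt0|rt0] := leP (rem Inelastic n t) 0.
  exact: le_trans (fcfs_rem_ge0 _ _ _ _ _).
have : 1 * (t - IF_start n) <= rem Inelastic n (IF_start n) - rem Inelastic n t.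
  apply: rem_decrement_ge => // s Ss st.
  have s0 : 0 <= s by apply: le_trans (ltW Ss).
  rewrite full//.
    rewrite /path_history (le_trans (arrival_le_start _ _ _ _) (ltW Ss))/=.
    exact: lt_le_trans (rem_nonincreasing _ _ s0 (ltW st)).
  apply: leq_ltn_trans (start_le_idle k_gt0 (ltW Ss)).
  apply: leq_sum => m _; case: (boolP (present s _ m)) => //= /andP[_ rm].
  have := lt_le_trans rm (IH m (ltn_ord m) s s0).
  by rewrite lt_max ltxx/= lt_min => /andP[_]; rewrite subr_gt0 => ->.
have := rem_le_size Inelastic n S0; have := rem_le_size Inelastic n t0.
rewrite /fcfs_rem le_max le_min completionE => *; apply/orP; right; lra.
Qed.

(** One list for both classes, because it is their total rate, not the rate of each class, that is
    compared with [k]. *)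
Definition jobs_among (N : nat) (PI PE : pred nat) : seq (job_class * nat) :=
  [seq (Inelastic, n) | n <- iota 0 N & PI n] ++
  [seq (Elastic, n) | n <- iota 0 N & PE n].

Lemma sum_jobs_among (V : nmodType) N PI PE (f : job_class -> nat -> V) :
  \sum_(j <- jobs_among N PI PE) f j.1 j.2 =
  \sum_(n < N | PI n) f Inelastic n + \sum_(n < N | PE n) f Elastic n.
Proof.
by rewrite big_cat !big_map !big_filter -{1 2}[N]subn0 !big_mkord.
Qed.

(** * Total work at a fixed time *)

Variables (t : R) (N : nat).
Hypothesis arrN : forall c n, arr c n <= t -> (n < N)%N.

(** The selected jobs lose at most [k%:R * (t - u)]. At [u] the elastic ones among them are
    untouched and the inelastic ones have at least their FCFS work; the elastic jobs before [m] can
    only add work at [t]. *)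
Lemma total_rem_ge m (u := arr Elastic m) : inelastic_fcfs pi -> u <= t ->
  \sum_(n < N | arr Inelastic n <= t) IF_rem n u +
  \sum_(n < N | (m <= n)%N && (arr Elastic n <= t)) size Elastic n
    - k%:R * (t - u) <=
  \sum_(n < N | arr Inelastic n <= t) rem Inelastic n t +
  \sum_(n < N | arr Elastic n <= t) rem Elastic n t.
Proof.
move=> fcfs ut; have u0 : 0 <= u by exact: arr_ge0.
have t0 := le_trans u0 ut.
pose PI n := arr Inelastic n <= t.
pose PE n := (m <= n)%N && (arr Elastic n <= t).
have := @sum_rem_decrement_le (jobs_among N PI PE) k%:R u t u0 ut.
rewrite sumrB (sum_jobs_among _ _ _ (fun c n => rem c n u))
  (sum_jobs_among _ _ _ (fun c n => rem c n t)) => decr.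
have {decr}/decr decr s : u < s -> s < t ->
    \sum_(j <- jobs_among N PI PE) rate j.1 j.2 s <= k%:R.
  move=> us st; rewrite (sum_jobs_among _ _ _ (fun c n => rate c n s)).
  apply: le_trans (state_alloc_le s).
  rewrite -!(@sum_rate _ s N); last 2 first.
  - by move=> n ns; apply: (arrN (le_trans ns (ltW st))).
  - by move=> n ns; apply: (arrN (le_trans ns (ltW st))).
  by apply: lerD; rewrite [leLHS]big_mkcond /=; apply: ler_sum => n _;
    case: ifP => // _; exact: rate_ge0.
have I_u : \sum_(n < N | PI n) IF_rem n u <=
    \sum_(n < N | PI n) rem Inelastic n u.
  by apply: ler_sum => n _; exact: fcfs_rem_le_rem.
have E_u : \sum_(n < N | PE n) rem Elastic n u =
    \sum_(n < N | PE n) size Elastic n.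
  by apply: eq_bigr => n /andP[mn _]; rewrite rem_before_arrival// arr_mono.
have E_t : \sum_(n < N | PE n) rem Elastic n t <=
    \sum_(n < N | arr Elastic n <= t) rem Elastic n t.
  rewrite [leLHS]big_mkcond [leRHS]big_mkcond /=; apply: ler_sum => n _.
  rewrite /PE; case: (m <= n)%N => //=.
  by case: ifP => // _; exact: rem_ge0.
by move: decr I_u E_u E_t; rewrite /PI /PE; lra.
Qed.

(** Each inequality of the lower bound is reversed: [busy] and work conservation keep [k] servers
    working, and all of this effort goes to the selected jobs, since the elastic jobs before [m] are
    finished at [u]. *)
Lemma total_rem_le m (u := arr Elastic m) : work_conserving k pi ->
  (forall m s, present s Inelastic m ->
    (num_earlier (present s) Inelastic m < k)%N -> rate Inelastic m s = 1) ->
  u <= t ->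
  (forall s, u < s -> s < t -> exists n, present s Elastic n) ->
  (forall n, (n < m)%N -> rem Elastic n u <= 0) ->
  \sum_(n < N | arr Inelastic n <= t) rem Inelastic n t +
  \sum_(n < N | arr Elastic n <= t) rem Elastic n t <=
  \sum_(n < N | arr Inelastic n <= t) IF_rem n u +
  \sum_(n < N | (m <= n)%N && (arr Elastic n <= t)) size Elastic n
    - k%:R * (t - u).
Proof.
move=> wc full ut busy done_m; have u0 : 0 <= u by exact: arr_ge0.
have t0 := le_trans u0 ut.
pose PI n := arr Inelastic n <= t.
pose PE n := (m <= n)%N && (arr Elastic n <= t).
have := @sum_rem_decrement_ge (jobs_among N PI PE) k%:R u t u0 ut.
rewrite sumrB (sum_jobs_among _ _ _ (fun c n => rem c n u))
  (sum_jobs_among _ _ _ (fun c n => rem c n t)) => decr.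
have {decr}/decr decr s : u < s -> s < t ->
    k%:R <= \sum_(j <- jobs_among N PI PE) rate j.1 j.2 s.
  move=> us st; rewrite (sum_jobs_among _ _ _ (fun c n => rate c n s)).
  have s0 := le_trans u0 (ltW us).
  have [n0 n0s] := busy s us st.
  have fs := present_finite s.
  have E0 : (0 < num_jobs (present s) Elastic)%N.
    by rewrite cardfs_gt0; apply/fset0Pn; exists n0; rewrite mem_jobs_in.
  rewrite -(wc.1 (num_jobs (present s) Inelastic) _ E0).
  rewrite -!(@sum_rate _ s N); last 2 first.
  - by move=> n ns; apply: (arrN (le_trans ns (ltW st))).
  - by move=> n ns; apply: (arrN (le_trans ns (ltW st))).
  (* The jobs left out get no service at [s]: they arrive after [t], or they are elastic jobs
     finished by [u]. *)
  apply: lerD; rewrite [leRHS]big_mkcond /=; apply: ler_sum => n _;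
    case: ifPn => //.
    rewrite /PI -ltNge => tn; rewrite rate_absent// /path_history negb_and.
    by rewrite -ltNge (lt_trans st).
  rewrite /PE negb_and -ltnNge -ltNge => /orP[nm|tn].
    rewrite rate_absent// /path_history negb_and orbC -leNgt.
    by rewrite (le_trans (rem_nonincreasing _ _ u0 (ltW us)))// done_m.
  rewrite rate_absent// /path_history negb_and.
  by rewrite -ltNge (lt_trans st).
have I_u : \sum_(n < N | PI n) rem Inelastic n u <=
    \sum_(n < N | PI n) IF_rem n u.
  by apply: ler_sum => n _; exact: rem_le_fcfs_rem.
have E_u : \sum_(n < N | PE n) rem Elastic n u <=
    \sum_(n < N | PE n) size Elastic n.
  by apply: ler_sum => n _; exact: rem_le_size.
have E_t : \sum_(n < N | arr Elastic n <= t) rem Elastic n t <=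
    \sum_(n < N | PE n) rem Elastic n t.
  rewrite [leLHS]big_mkcond [leRHS]big_mkcond /=; apply: ler_sum => n _.
  rewrite /PE; case: (leqP m n) => //= nm; case: ifP => // _.
  by rewrite (le_trans (rem_nonincreasing _ _ u0 ut))// done_m.
by move: decr I_u E_u E_t; rewrite /PI /PE; lra.
Qed.

Hypothesis t_ge0 : 0 <= t.

Local Notation path_work c t :=
  (\sum_(0 <= n <oo) if present t c n then (rem c n t)%:E else 0)%E.
Local Notation IF_work :=
  (fcfs_work k (arr Inelastic) (size Inelastic)).
Local Notation bound_at :=
  (work_bound k (arr Inelastic) (size Inelastic) (arr Elastic) (size Elastic)).

(** The presence test reduces to the arrival test: remaining sizes are nonnegative, so an arrived
    job that is absent contributes 0. *)
Lemma path_workE c :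
  path_work c t = (\sum_(n < N | arr c n <= t) rem c n t)%:E.
Proof.
rewrite (@eseries_cond_finite _ (fun n => present t c n) _ N); last first.
  by move=> n /andP[/arrN].
congr EFin; rewrite big_mkcond [RHS]big_mkcond; apply: eq_bigr => n _.
rewrite /path_history; case: (leP (arr c n)) => //= _.
by case: ltrgt0P (rem_ge0 (size_gt0 c n) t_ge0) => // ->.
Qed.

Lemma IF_workE u :
  IF_work t u = (\sum_(n < N | arr Inelastic n <= t) IF_rem n u)%:E.
Proof. by apply: eseries_cond_finite => n; exact: arrN. Qed.

Lemma IF_boundE m : bound_at m t =
  (\sum_(n < N | arr Inelastic n <= t) IF_rem n (arr Elastic m) +
   \sum_(n < N | (m <= n)%N && (arr Elastic n <= t)) size Elastic n
   - k%:R * (t - arr Elastic m))%:E.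
Proof.
rewrite /work_bound IF_workE /late_work.
rewrite (@eseries_cond_finite _
  (fun n => (m <= n)%N && (arr Elastic n <= t)) _ N).
  by congr (_ + _ - _)%:E; apply: eq_bigr => n _; rewrite gtr0_norm.
by move=> n /andP[_ /arrN].
Qed.

Lemma inelastic_path_work_ge : inelastic_fcfs pi ->
  (IF_work t t <= path_work Inelastic t)%E.
Proof.
move=> fcfs; rewrite IF_workE path_workE lee_fin.
by apply: ler_sum => n _; exact: fcfs_rem_le_rem.
Qed.

Lemma path_work_ge0 c : (0 <= path_work c t)%E.
Proof. by rewrite path_workE lee_fin sumr_ge0// => n _; exact: rem_ge0. Qed.

Lemma path_work_ge_bound m : inelastic_fcfs pi -> arr Elastic m <= t ->
  (bound_at m t <= path_work Inelastic t + path_work Elastic t)%E.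
Proof.
move=> fcfs mt; rewrite IF_boundE !path_workE -EFinD lee_fin.
exact: total_rem_ge.
Qed.

Hypothesis full_service : forall n s, present s Inelastic n ->
  (num_earlier (present s) Inelastic n < k)%N -> rate Inelastic n s = 1.

Lemma inelastic_path_work_le : (path_work Inelastic t <= IF_work t t)%E.
Proof.
rewrite IF_workE path_workE lee_fin.
by apply: ler_sum => n _; exact: rem_le_fcfs_rem.
Qed.

(* The bound is attained for the arrival [m] that starts the current elastic
   busy period: since then all [k] servers have been busy. *)
Lemma path_work_le_bound : work_conserving k pi ->
  (path_work Inelastic t + path_work Elastic t <= IF_work t t)%E \/
  exists2 m, arr Elastic m <= t &
    (path_work Inelastic t + path_work Elastic t <= bound_at m t)%E.
Proof.
move=> wc; have [none|/existsNP[n /contrapT nt]] :=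
  pselect (forall n, ~ present t Elastic n).
  left; rewrite [X in (_ + X)%E]eseries0 ?adde0 ?inelastic_path_work_le//.
  by move=> n _ _; case: ifP => // /none.
(* The elastic job present at [s] may vary with [s]. The least such [m] opens the busy period, and
   any elastic job present at [t] shows that one exists. *)
right; pose starts m := `[< arr Elastic m <= t /\
  forall s, arr Elastic m <= s -> s <= t -> exists n, present s Elastic n >].
have present_from l v : arr Elastic l <= v -> v <= t -> 0 < rem Elastic l t ->
    present v Elastic l.
  move=> lv vt lt0; rewrite /path_history lv (lt_le_trans lt0)//.
  by apply: rem_nonincreasing => //; apply: le_trans lv.
have ex_m : exists m, starts m.
  have /andP[nt1 nt2] := nt; exists n; apply/asboolP; split=> // s ns st.
  by exists n; exact: present_from.
have [m /asboolP[mt busy] m_min] := ex_minnP ex_m; exists m => //.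
have u0 := arr_ge0 Elastic m.
rewrite IF_boundE !path_workE -EFinD lee_fin; apply: total_rem_le => //.
  by move=> s us st; exact: busy (ltW us) (ltW st).
(* A job [l] before [m] with work left at the arrival of [m] would fill the time since its own
   arrival, against the minimality of [m]. *)
move=> l lm; rewrite leNgt; apply/negP => rl0.
suff /m_min : starts l by rewrite leqNgt lm.
have lm' := arr_mono Elastic (ltnW lm).
apply/asboolP; split=> [|s ls st]; first exact: le_trans mt.
have [/ltW sm|ms] := ltP s (arr Elastic m); last exact: busy.
exists l; rewrite /path_history ls (lt_le_trans rl0)//.
by apply: rem_nonincreasing => //; exact: le_trans ls.
Qed.

End SamplePath.

(** * The law of the primitives *)

HB.instance Definition _ := gen_eqMixin job_class.
HB.instance Definition _ := gen_choiceMixin job_class.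

Section Cylinders.
Variables (R : realType) (J : choiceType).

Definition rectangle (s : seq J) (B : J -> set R) : set (J -> R) :=
  [set x | forall j, j \in s -> B j (x j)].

Definition cylinders : set (set (J -> R)) :=
  [set A | exists s B, (forall j, measurable (B j)) /\ A = rectangle s B].

(** This is [J -> R] with the product sigma-algebra, a common space on which the primitives of both
    systems have their laws. *)
Definition families : measurableType cylinders.-sigma :=
  g_sigma_algebraType cylinders.

Lemma setI_closed_cylinders : setI_closed cylinders.
Proof.
move=> _ _ [s1 [B1 [mB1 ->]]] [s2 [B2 [mB2 ->]]].
exists (s1 ++ s2), (fun j => (if j \in s1 then B1 j else setT) `&`
                             (if j \in s2 then B2 j else setT)); split.
  by move=> j; apply: measurableI; case: ifP.
apply/seteqP; split=> x /=.
  move=> [x1 x2] j _; split; case: ifP => // js; [exact: x1|exact: x2].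
move=> x12; split=> j js; have := x12 j; rewrite mem_cat js ?orbT => /(_ erefl).
- by case.
- by case.
Qed.

Lemma measurable_coordinate (j : J) :
  measurable_fun setT (fun x : families => x j).
Proof.
move=> _ B mB; rewrite setTI; apply: sub_sigma_algebra.
exists [:: j], (fun=> B); split => //; apply/seteqP; split=> x /=.
  by move=> xj i; rewrite inE => /eqP ->.
by apply; rewrite mem_head.
Qed.

Lemma measurable_family d (T : measurableType d) (X : J -> T -> R) :
  (forall j, measurable_fun setT (X j)) ->
  measurable_fun setT (fun w => (fun j => X j w) : families).
Proof.
move=> mX; apply: (@measurability _ _ T families setT _ cylinders) =>
  // _ [_ [s [B [mB ->]]] <-].
have -> : setT `&` (fun w => (fun j => X j w) : families) @^-1` rectangle s B =
    \bigcap_(j in [set` s]) (X j @^-1` B j).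
  by rewrite setTI.
apply: fin_bigcap_measurable => // j _.
by rewrite -[X in measurable X]setTI; exact: mX.
Qed.

Context {d1 d2} {T1 : measurableType d1} {T2 : measurableType d2}.
Variables (P1 : probability T1 R) (P2 : probability T2 R).
Variables (X1 : J -> {RV P1 >-> R}) (X2 : J -> {RV P2 >-> R}).

(** Uniqueness of measures on a pi-system: on a cylinder, independence turns both laws into products
    of equal marginals. *)
Lemma independent_same_law :
  mutually_independent X1 -> mutually_independent X2 ->
  (forall j B, measurable B -> P1 (X1 j @^-1` B) = P2 (X2 j @^-1` B)) ->
  forall A : set families, measurable A ->
  P1 [set w | A (X1 ^~ w)] = P2 [set w | A (X2 ^~ w)].
Proof.
move=> ind1 ind2 marg A mA.
have mX1 : measurable_fun setT (fun w => X1 ^~ w : families).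
  by apply: measurable_family.
have mX2 : measurable_fun setT (fun w => X2 ^~ w : families).
  by apply: measurable_family.
apply: (@measure_unique _ R families cylinders (fun=> setT) _ _ _ _
  (pushforward P1 (fun w => X1 ^~ w : families))
  (pushforward P2 (fun w => X2 ^~ w : families))) => //.
- exact: setI_closed_cylinders.
- move=> _; exists [::], (fun=> setT); split=> //.
  by apply/seteqP; split=> x.
- by rewrite bigcup_const//; exists 0%N.
- move=> _ [s [B [mB ->]]]; rewrite /pushforward.
  (* Independence is stated for injective enumerations of indices, so repetitions are removed
     first. *)
  have -> : rectangle s B = rectangle (undup s) B.
    by apply/seteqP; split=> x xs j js; apply: xs; move: js; rewrite mem_undup.
  have us := undup_uniq s; move: (undup s) us => {}s us.
  pose f i := tnth (in_tuple s) i.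
  have f_inj : injective f by apply/tuple_uniqP.
  have preimage_rect (T : Type) (X : J -> T -> R) :
      (fun w => X ^~ w) @^-1` rectangle s B =
      \bigcap_(i in [set: 'I_(seq.size s)]) (X (f i) @^-1` B (f i)).
    apply/seteqP; split=> w /=.
      by move=> ws i _; apply: ws; exact: mem_tnth.
    by move=> ws j /(tnthP (in_tuple s)) [i ->]; exact: ws.
  transitivity (P1 (\bigcap_(i in setT) (X1 (f i) @^-1` B (f i)))).
    by congr (P1 _); exact: (preimage_rect T1 (fun j => X1 j)).
  transitivity (P2 (\bigcap_(i in setT) (X2 (f i) @^-1` B (f i)))); last first.
    by congr (P2 _); apply/esym; exact: (preimage_rect T2 (fun j => X2 j)).
  rewrite ind1// ind2//.
  by apply: eq_bigr => i _; exact: marg.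
- move=> _; apply: (@le_lt_trans _ _ (P1 setT)); first exact: lexx.
  by rewrite probability_setT ltry.
Qed.

End Cylinders.

(** * Exponential variables and renewal sequences *)

Section Exponential.
Context {R : realType} {d} {T : measurableType d}.
Variable P : probability T R.

(** The density vanishes on the negative half-line, and the endpoint 0 is null for Lebesgue
    measure. *)
Lemma ae_exponential_gt0 (X : {RV P >-> R}) (r : R) :
  exponentially_distributed X r -> {ae P, forall w, 0 < X w}.
Proof.
move=> expX; exists (X @^-1` `]-oo, 0]); split.
- by rewrite -[X in measurable X]setTI; exact: measurable_funP.
- have := expX `]-oo, 0]%classic; rewrite /distribution /pushforward => ->//.
  rewrite /exponential_prob -integral_itv_bndo_bndc.
    by rewrite integral0_eq// => x /=; rewrite in_itv/= => x0;
      rewrite lt0_exponential_pdf.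
  apply/measurable_EFinP; apply: measurable_funTS.
  exact: measurable_exponential_pdf.
- by move=> w /negP; rewrite -leNgt /= in_itv.
Qed.

Lemma exponential_le1_lt1 (X : {RV P >-> R}) (r : R) : 0 < r ->
  exponentially_distributed X r -> (P (X @^-1` `]-oo, 1%R]) < 1)%E.
Proof.
move=> r0 expX.
have neg0 : exponential_prob r `]-oo, 0[ = 0%E.
  rewrite /exponential_prob integral0_eq// => x /=; rewrite in_itv/= => x0.
  by rewrite lt0_exponential_pdf.
have -> : P (X @^-1` `]-oo, 1%R]) =
    (distribution P X `]-oo, 0%R[ + distribution P X `[0%R, 1%R])%E.
  rewrite -measureU//; last first.
    rewrite -subset0 => x /= []; rewrite !in_itv /=; lra.
  congr (P (X @^-1` _)); apply/seteqP; split=> x /=; rewrite !in_itv /=.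
    by move=> x1; case: (ltP x 0) => x0; [left|right].
  by case=> [/ltW x0|/andP[]//]; rewrite (le_trans x0).
rewrite !expX// neg0 add0e exponential_prob_itv0c// lte_fin.
by rewrite ltrBlDr ltrDl expR_gt0.
Qed.

End Exponential.

Section Renewal.
Context {R : realType} {d} {T : measurableType d}.
Variable P : probability T R.

Lemma mutually_independent_comp (I J : Type) (f : I -> J)
    (X : J -> {RV P >-> R}) : injective f -> mutually_independent X ->
  mutually_independent (fun i => X (f i)).
Proof.
move=> f_inj ind m g B g_inj mB.
by apply: (ind m (f \o g)) => //; exact: inj_comp.
Qed.

Lemma measure_le_ae (A B : set T) : measurable A -> measurable B ->
  {ae P, forall w, A w -> B w} -> (P A <= P B)%E.
Proof.
move=> mA mB [C [mC C0 subC]].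
apply: (@le_trans _ _ (P (B `|` C))).
  apply: le_measure; rewrite ?inE//; first exact: measurableU.
  move=> w Aw; have [Bw|nBw] := pselect (B w); [by left|right].
  by apply: subC => /(_ Aw).
by rewrite -[leRHS]adde0 -C0; exact: measureU2.
Qed.

Variables (X : nat -> {RV P >-> R}) (r : R).
Hypothesis r_gt0 : 0 < r.
Hypothesis indX : mutually_independent X.
Hypothesis expX : forall n, exponentially_distributed (X n) r.

(** By independence, [j] given gaps are all at most 1 with probability [q ^+ j], where [q < 1]; this
    tends to 0. *)
Lemma ae_gap_gt1 n : {ae P, forall w, exists2 m, (n <= m)%N & 1 < X m w}.
Proof.
pose A := \bigcap_m (X (n + m)%N @^-1` `]-oo, 1%R]).
have mA : measurable A.
  apply: bigcap_measurable => [|m _]; first by exists 0%N.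
  by rewrite -[X in measurable X]setTI; exact: measurable_funP.
exists A; split => //; last first.
  move=> w /forall2NP now m _ /=; rewrite in_itv/= leNgt; apply/negP => Xm.
  by have [/negP|//] := now (n + m)%N; rewrite leq_addr.
pose q := fine (P (X 0%N @^-1` `]-oo, 1%R])).
have qE m : P (X m @^-1` `]-oo, 1%R]) = q%:E.
  rewrite fineK ?fin_num_measure//; last first.
    by rewrite -[X in measurable X]setTI; exact: measurable_funP.
  by transitivity (exponential_prob r `]-oo, 1%R]); [|apply/esym]; exact: expX.
have q0 : 0 <= q by rewrite -lee_fin -(qE 0%N).
have q1 : q < 1.
  by rewrite -lte_fin -(qE 0%N); exact: exponential_le1_lt1 (expX _).
have PA j : (P A <= (q ^+ j)%:E)%E.
  have := @indX j (fun i => (n + i)%N) (fun=> `]-oo, 1%R]%classic).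
  rewrite (eq_bigr (fun=> q%:E)) => [|i _]; last exact: qE.
  rewrite prodEFin prodr_const card_ord => <-//; last first.
    by move=> i i' /addnI /val_inj.
  apply: le_measure; rewrite ?inE//.
    apply: fin_bigcap_measurable => // i _.
    by rewrite -[X in measurable X]setTI; exact: measurable_funP.
  by move=> w Aw i _; exact: Aw.
apply/eqP; rewrite eq_le measure_ge0 andbT.
apply/lee_addgt0Pr => e e0; rewrite add0e.
have /cvgr0Pnorm_lt/(_ _ e0) [j _ /(_ j (leqnn j)) /= qj] :
    q ^+ j @[j --> \oo] --> 0 by apply: cvg_expr; rewrite ger0_norm.
apply: le_trans (PA j) _; rewrite lee_fin ltW//.
by apply: le_lt_trans qj; exact: ler_norm.
Qed.

(** The gaps are positive and infinitely many exceed 1, so the partial sums pass every integer in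
    turn. Hence only finitely many jobs arrive by any given time. *)
Lemma ae_renewal_unbounded :
  {ae P, forall w, forall K : R, exists M, K < \sum_(m < M) X m w}.
Proof.
have pos : {ae P, forall w, forall n, 0 < X n w}.
  by apply: ae_foralln => n; exact: ae_exponential_gt0 (expX n).
have big : {ae P, forall w, forall n, exists2 m, (n <= m)%N & 1 < X m w}.
  by apply: ae_foralln => n; exact: ae_gap_gt1.
apply: filterS2 pos big => w X0 X1 K.
suff [M KM] : exists M, (Num.truncn K).+1%:R <= \sum_(m < M) X m w.
  by exists M; apply: lt_le_trans KM; exact: truncnS_gt.
elim: (Num.truncn K).+1 => [|j [M jM]].
  by exists 0%N; rewrite big_ord0.
have [m Mm Xm] := X1 M; exists m.+1.
rewrite big_ord_recr /= -natr1 lerD ?(ltW Xm)//.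
rewrite (le_trans jM)// -!(big_mkord xpredT (fun i => X i w)).
by rewrite (big_cat_nat (leq0n M) Mm)//= lerDl sumr_ge0// => i _; exact/ltW.
Qed.

End Renewal.

(** * Comparison of the events *)

Section Measurability.
Context {R : realType} {d} {T : measurableType d}.

Lemma measurable_bigmaxr (I : Type) (s : seq I) (a : T -> R) (F : I -> T -> R) :
  measurable_fun setT a -> (forall i, measurable_fun setT (F i)) ->
  measurable_fun setT (fun w => \big[Num.max/a w]_(i <- s) F i w).
Proof.
move=> ma mF; elim: s => [|i s IH]; first by under eq_fun do rewrite big_nil.
by under eq_fun do rewrite big_cons; exact: measurable_maxr.
Qed.

Lemma measurable_sumn (I : Type) (s : seq I) (b : I -> T -> bool) :
  (forall i, measurable_fun setT (b i)) ->
  measurable_fun setT (fun w => (\sum_(i <- s) b i w)%N).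
Proof.
move=> mb; elim: s => [|i s IH].
  by under eq_fun do rewrite big_nil; exact: measurable_cst.
under eq_fun do rewrite big_cons; apply: measurable_fun_addn => //.
exact: (measurableT_comp (f := nat_of_bool)).
Qed.

Lemma measurable_eseries (h : nat -> T -> \bar R) :
  (forall n w, (0 <= h n w)%E) -> (forall n, measurable_fun setT (h n)) ->
  measurable_fun setT (fun w => \sum_(0 <= n <oo) h n w)%E.
Proof.
move=> h0 mh; exact: (@ge0_emeasurable_sum _ _ _ setT h xpredT).
Qed.

Lemma measurable_gt (f : T -> \bar R) (x : R) : measurable_fun setT f ->
  measurable [set w | (x%:E < f w)%E].
Proof.
move=> mf; rewrite -[X in measurable X]setTI.
exact: emeasurable_fun_o_infty.
Qed.

Lemma measurable_le (f : T -> R) (x : R) : measurable_fun setT f ->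
  measurable [set w | f w <= x].
Proof.
move=> mf; rewrite -[X in measurable X]setTI.
rewrite (_ : [set w | _] = (f @^-1` `]-oo, x]%classic)); first exact: mf.
by apply/seteqP; split=> w /=; rewrite in_itv.
Qed.

Variables (k : nat) (a z : nat -> T -> R).
Hypothesis ma : forall n, measurable_fun setT (a n).
Hypothesis mz : forall n, measurable_fun setT (z n).

Lemma measurable_start_after (D : nat -> T -> R) n :
  (forall m, measurable_fun setT (D m)) ->
  measurable_fun setT (fun w => start_after k (a ^~ w) (D ^~ w) n).
Proof.
move=> mD; apply: measurable_bigmaxr => // i.
apply: measurable_fun_ifT => //; apply: measurable_fun_leq => //.
by apply: measurable_sumn => j; exact: measurable_fun_ler.
Qed.

Lemma measurable_completion n :
  measurable_fun setT (fun w => completion k (a ^~ w) (z ^~ w) n).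
Proof.
(* The number of rounds is separated from the index, since a round at [n] uses the previous round at
   other indices. *)
rewrite /completion; move: n.+1 => j; elim: j n => [|j IH] n //=.
by apply: measurable_funD => //; exact: measurable_start_after.
Qed.

Lemma measurable_fcfs_rem n (u : T -> R) : measurable_fun setT u ->
  measurable_fun setT (fun w => fcfs_rem k (a ^~ w) (z ^~ w) n (u w)).
Proof.
move=> mu; apply: measurable_maxr => //; apply: measurable_minr => //.
by apply: measurable_funB => //; exact: measurable_completion.
Qed.

Lemma measurable_fcfs_work t (u : T -> R) : measurable_fun setT u ->
  measurable_fun setT (fun w => fcfs_work k (a ^~ w) (z ^~ w) t (u w)).
Proof.
move=> mu; apply: measurable_eseries => [n w|n].
  by case: ifP => // _; rewrite lee_fin fcfs_rem_ge0.
apply: measurable_fun_ifT => //; first exact: measurable_fun_ler.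
by apply/measurable_EFinP; exact: measurable_fcfs_rem.
Qed.

Lemma measurable_late_work m t :
  measurable_fun setT (fun w => late_work (a ^~ w) (z ^~ w) m t).
Proof.
apply: measurable_eseries => [n w|n]; first by case: ifP.
apply: measurable_fun_ifT => //.
  by apply: measurable_and => //; exact: measurable_fun_ler.
by apply/measurable_EFinP; exact: measurableT_comp.
Qed.

End Measurability.

Lemma measurable_work_bound {R : realType} {d} {T : measurableType d}
    (k : nat) (aI zI aE zE : nat -> T -> R) (m : nat) (t : R) :
  (forall n, measurable_fun setT (aI n)) ->
  (forall n, measurable_fun setT (zI n)) ->
  (forall n, measurable_fun setT (aE n)) ->
  (forall n, measurable_fun setT (zE n)) ->
  measurable_fun setT
    (fun w => work_bound k (aI ^~ w) (zI ^~ w) (aE ^~ w) (zE ^~ w) m t).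
Proof.
move=> maI mzI maE mzE; apply: emeasurable_funB.
  apply: emeasurable_funD; first exact: measurable_fcfs_work.
  exact: measurable_late_work.
apply/measurable_EFinP; apply: measurable_funM => //.
exact: measurable_funB.
Qed.

(** * Arrival times and almost sure regularity of a system *)

Section ArrivalTimes.
Context {R : realType}.
Variables (n0 : job_class -> nat) (g : job_class -> nat -> R).
Hypothesis g_gt0 : forall c n, 0 < g c n.

Lemma arrival_time_ge0 c n : 0 <= arrival_time n0 g c n.
Proof. by apply: sumr_ge0 => m _; exact/ltW. Qed.

Lemma arrival_time_mono c m n : (m <= n)%N ->
  arrival_time n0 g c m <= arrival_time n0 g c n.
Proof.
move=> mn; rewrite /arrival_time -!(big_mkord xpredT (g c)).
rewrite [leRHS](@big_cat_nat _ _ _ (m.+1 - n0 c)) ?leq_sub2r//= lerDl.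
by apply: sumr_ge0 => i _; exact/ltW.
Qed.

Lemma arrival_time_locally_finite (t : R) :
  (forall c K, exists M, K < \sum_(m < M) g c m) ->
  exists N, forall c n, arrival_time n0 g c n <= t -> (n < N)%N.
Proof.
move=> unb.
have bnd c : exists N, forall n, arrival_time n0 g c n <= t -> (n < N)%N.
  (* From the job [n0 c + M] on, an arrival time includes at least the first [M] gaps, whose sum
     already exceeds [t]. *)
  have [M tM] := unb c t; exists (n0 c + M)%N => n; rewrite ltnNge.
  apply: contraTN => nM; rewrite -ltNge; apply: lt_le_trans tM _.
  rewrite /arrival_time -!(big_mkord xpredT (g c)).
  rewrite [leRHS](@big_cat_nat _ _ _ M)//=; last by lia.
  by rewrite lerDl; apply: sumr_ge0 => i _; exact/ltW.
have [NI hI] := bnd Inelastic; have [NE hE] := bnd Elastic.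
exists (maxn NI NE) => -[] n nt; rewrite leq_max.
- by rewrite (hI n nt).
- by rewrite (hE n nt) orbT.
Qed.

End ArrivalTimes.

Section System.
Context {R : realType} {d} {T : measurableType d} {P : probability T R}.
Variables (lambda mu : job_class -> R) (n0 : job_class -> nat) (pi : policy R).
Variable S : system P.
Hypothesis lambda_gt0 : forall c, 0 < lambda c.
Hypothesis HS : is_system lambda mu n0 pi S.

(** Gathers in one almost sure event what the sample path lemmas assume. *)
Lemma ae_regular : {ae P, forall w,
  [/\ forall c n, 0 < size S c n w, forall c n, 0 < gap S c n w,
      forall c K, exists M, K < \sum_(m < M) gap S c m w &
      is_sample_path pi (arrival n0 S w) (fun c n => size S c n w)
        (fun c n t => remaining S c n t w)]}.
Proof.
have [exp_gap exp_size ind path] := HS.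
have ae_class (Q : job_class -> T -> Prop) :
    (forall c, {ae P, forall w, Q c w}) -> {ae P, forall w, forall c, Q c w}.
  by move=> aeQ; apply: filterS2 (aeQ Inelastic) (aeQ Elastic) => w QI QE [].
have size0 : {ae P, forall w, forall c n, 0 < size S c n w}.
  apply: ae_class => c; apply: ae_foralln => n.
  exact: ae_exponential_gt0 (exp_size c n).
have gap0 : {ae P, forall w, forall c n, 0 < gap S c n w}.
  apply: ae_class => c; apply: ae_foralln => n.
  exact: ae_exponential_gt0 (exp_gap c n).
have unb : {ae P, forall w, forall c K, exists M, K < \sum_(m < M) gap S c m w}.
  apply: ae_class => c.
  apply: (@ae_renewal_unbounded _ _ _ P (gap S c) (lambda c)) => //.
  by apply: (@mutually_independent_comp _ _ _ P _ _ (fun n => inl (c, n))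
    (primitives S)) => // m n [].
apply: filterS2 (filterI size0 gap0) (filterI unb path) => w [? ?] [? ?].
by split.
Qed.

Lemma measurable_arrival c n :
  measurable_fun setT (fun w => arrival n0 S w c n).
Proof. by apply: measurable_sum => i; exact: measurable_funP. Qed.

Lemma measurable_class_work c t : measurable_fun setT (class_work n0 S c t).
Proof.
apply: measurable_eseries => [n w|n].
  by case: ifP => // /andP[_ /ltW]; rewrite lee_fin.
apply: measurable_fun_ifT => //; last first.
  by apply/measurable_EFinP; exact: measurable_funP.
apply: measurable_and.
  by apply: measurable_fun_ler => //; exact: measurable_arrival.
by apply: measurable_fun_ltr => //; exact: measurable_funP.
Qed.

Lemma measurable_total_work t : measurable_fun setT (total_work n0 S t).
Proof. by apply: emeasurable_funD; exact: measurable_class_work. Qed.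

End System.

(** * Comparison events on the space of primitives *)

Section InelasticFirst.
Context {R : realType}.
Variables (k : nat) (n0 : job_class -> nat).
Let J := ((job_class * nat) + (job_class * nat))%type.
Local Notation families := (families R J).

Definition family_arrival (v : families) (c : job_class) (n : nat) : R :=
  arrival_time n0 (fun c n => v (inl (c, n))) c n.

Definition family_size (v : families) (c : job_class) (n : nat) : R :=
  v (inr (c, n)).

Definition IF_inelastic_work (t : R) (v : families) : \bar R :=
  fcfs_work k (family_arrival v Inelastic) (family_size v Inelastic) t t.

Definition IF_bound (m : nat) (t : R) (v : families) : \bar R :=
  work_bound k (family_arrival v Inelastic) (family_size v Inelastic)
    (family_arrival v Elastic) (family_size v Elastic) m t.

Definition IF_inelastic_event (t x : R) : set families :=
  [set v | (x%:E < IF_inelastic_work t v)%E].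

(** The event that the supremum of the lower bounds exceeds [x], written as a countable union; only
    elastic arrivals up to [t] give a bound. *)
Definition IF_event (t x : R) : set families :=
  IF_inelastic_event t x `|`
  \bigcup_m ([set v | family_arrival v Elastic m <= t] `&`
             [set v | (x%:E < IF_bound m t v)%E]).

Lemma measurable_family_arrival c n :
  measurable_fun setT (fun v => family_arrival v c n).
Proof. by apply: measurable_sum => i; exact: measurable_coordinate. Qed.

Lemma measurable_family_size c n :
  measurable_fun setT (fun v => family_size v c n).
Proof. exact: measurable_coordinate. Qed.

Lemma measurable_IF_inelastic_event t x : measurable (IF_inelastic_event t x).
Proof.
apply: measurable_gt.
apply: (@measurable_fcfs_work _ _ _ k (fun n v => family_arrival v Inelastic n)
  (fun n v => family_size v Inelastic n) _ _ t (fun=> t)) => // n.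
- exact: measurable_family_arrival.
- exact: measurable_family_size.
Qed.

Lemma measurable_IF_event t x : measurable (IF_event t x).
Proof.
apply: measurableU; first exact: measurable_IF_inelastic_event.
apply: bigcupT_measurable => m; apply: measurableI.
  by apply: measurable_le; exact: measurable_family_arrival.
apply: measurable_gt.
apply: (@measurable_work_bound _ _ _ k (fun n v => family_arrival v Inelastic n)
  (fun n v => family_size v Inelastic n)
  (fun n v => family_arrival v Elastic n)
  (fun n v => family_size v Elastic n)) => n;
  by [exact: measurable_family_arrival | exact: measurable_family_size].
Qed.

Context {d} {T : measurableType d} {P : probability T R}.
Variables (lambda mu : job_class -> R) (S : system P) (pi : policy R).
Hypothesis k_gt0 : (0 < k)%N.
Hypothesis lambda_gt0 : forall c, 0 < lambda c.
Variables (t x : R).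
Hypothesis t_ge0 : 0 <= t.

Lemma measurable_primitives_preimage (A : set families) : measurable A ->
  measurable [set w | A (primitives S ^~ w)].
Proof.
move=> mA; rewrite -[X in measurable X]setTI.
by apply: (measurable_family (X := primitives S)).
Qed.

(** Almost surely every functional in the events is a lower bound for the work, so exceeding [x]
    passes on to the work. *)
Lemma IF_event_class_P : is_system lambda mu n0 pi S -> class_P k pi ->
  (P [set w | IF_inelastic_event t x (primitives S ^~ w)] <=
     P [set w | (x%:E < class_work n0 S Inelastic t w)%E])%E /\
  (P [set w | IF_event t x (primitives S ^~ w)] <=
     P [set w | (x%:E < total_work n0 S t w)%E])%E.
Proof.
move=> HS [feas wc fcfs]; have reg := ae_regular lambda_gt0 HS.
split; apply: measure_le_ae.
- apply: measurable_primitives_preimage.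
  exact: measurable_IF_inelastic_event.
- by apply: measurable_gt; exact: measurable_class_work.
- apply: filterS reg => w [size0 gap0 unb path] /= /lt_le_trans; apply.
  have [N arrN] := arrival_time_locally_finite n0 gap0 t unb.
  have arr0 := arrival_time_ge0 n0 gap0.
  have arr_mono := arrival_time_mono n0 gap0.
  have arr_fin s := arrival_time_locally_finite n0 gap0 s unb.
  exact: (inelastic_path_work_ge feas arr0 arr_fin path arr_mono size0 arrN).
- by apply: measurable_primitives_preimage; exact: measurable_IF_event.
- by apply: measurable_gt; exact: measurable_total_work.
- apply: filterS reg => w [size0 gap0 unb path] /=.
  have [N arrN] := arrival_time_locally_finite n0 gap0 t unb.
  have arr0 := arrival_time_ge0 n0 gap0.
  have arr_mono := arrival_time_mono n0 gap0.
  have arr_fin s := arrival_time_locally_finite n0 gap0 s unb.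
  case=> [/lt_le_trans|[m _ [/= mt /lt_le_trans]]]; apply.
    apply: (@le_trans _ _ (class_work n0 S Inelastic t w)).
      exact: (inelastic_path_work_ge feas arr0 arr_fin path arr_mono size0 arrN).
    apply: leeDl.
    exact: (path_work_ge0 feas arr_fin path size0 arrN t_ge0 Elastic).
  exact: (path_work_ge_bound feas arr0 arr_fin path arr_mono size0 arrN).
Qed.

(** Conversely, under Inelastic-First the work is almost surely at most one of these functionals. *)
Lemma IF_event_IF : is_system lambda mu n0 (IF R k) S ->
  (P [set w | (x%:E < class_work n0 S Inelastic t w)%E] <=
     P [set w | IF_inelastic_event t x (primitives S ^~ w)])%E /\
  (P [set w | (x%:E < total_work n0 S t w)%E] <=
     P [set w | IF_event t x (primitives S ^~ w)])%E.
Proof.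
move=> HS; have reg := ae_regular lambda_gt0 HS.
have feas := IF_feasible R k; have wc := IF_work_conserving R k.
have full (arr : job_class -> nat -> R) rem n s :
    path_history arr rem s Inelastic n ->
    (num_earlier (path_history arr rem s) Inelastic n < k)%N ->
    path_rate (IF R k) arr rem Inelastic n s = 1.
  move=> ns early; rewrite /path_rate IF_division_inelastic history_until_now//.
  by rewrite early.
split; apply: measure_le_ae.
- by apply: measurable_gt; exact: measurable_class_work.
- apply: measurable_primitives_preimage.
  exact: measurable_IF_inelastic_event.
- apply: filterS reg => w [size0 gap0 unb path] /= /lt_le_trans; apply.
  have [N arrN] := arrival_time_locally_finite n0 gap0 t unb.
  have arr0 := arrival_time_ge0 n0 gap0.
  have arr_mono := arrival_time_mono n0 gap0.
  have arr_fin s := arrival_time_locally_finite n0 gap0 s unb.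
  exact: (inelastic_path_work_le feas arr0 arr_fin path k_gt0 size0 arrN t_ge0
    (full _ _)).
- by apply: measurable_gt; exact: measurable_total_work.
- by apply: measurable_primitives_preimage; exact: measurable_IF_event.
- apply: filterS reg => w [size0 gap0 unb path] /= xW.
  have [N arrN] := arrival_time_locally_finite n0 gap0 t unb.
  have arr0 := arrival_time_ge0 n0 gap0.
  have arr_mono := arrival_time_mono n0 gap0.
  have arr_fin s := arrival_time_locally_finite n0 gap0 s unb.
  have [W|[m mt W]] := path_work_le_bound feas arr0 arr_fin path k_gt0 arr_mono
      size0 arrN t_ge0 (full _ _) wc.
    by left; exact: lt_le_trans xW W.
  by right; exists m => //; split=> //=; exact: lt_le_trans xW W.
Qed.

End InelasticFirst.

Theorem theorem3 (R : realType) (k : nat) (lambdaI lambdaE muI muE : R)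
    (hk : (1 <= k)%N)
    (hlambdaI : 0 < lambdaI) (hlambdaE : 0 < lambdaE)
    (hmuI : 0 < muI) (hmuE : 0 < muE)
    (hrho : lambdaI / (k%:R * muI) + lambdaE / (k%:R * muE) < 1)
    (pi : policy R) (hpi : class_P k pi)
    (i0 j0 : nat)
    (d1 : measure_display) (T1 : measurableType d1) (P1 : probability T1 R)
    (S_IF : system P1)
    (hIF : is_system (by_class lambdaI lambdaE) (by_class muI muE)
             (by_class i0 j0) (IF R k) S_IF)
    (d2 : measure_display) (T2 : measurableType d2) (P2 : probability T2 R)
    (S_pi : system P2)
    (hS : is_system (by_class lambdaI lambdaE) (by_class muI muE)
            (by_class i0 j0) pi S_pi)
    (t : R) (ht : 0 <= t) :
  st_le P1 P2 (total_work (by_class i0 j0) S_IF t)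
              (total_work (by_class i0 j0) S_pi t) /\
  st_le P1 P2 (class_work (by_class i0 j0) S_IF Inelastic t)
              (class_work (by_class i0 j0) S_pi Inelastic t).
Proof.
have lambda_gt0 c : 0 < by_class lambdaI lambdaE c by case: c.
have [exp_gap1 exp_size1 ind1 _] := hIF; have [exp_gap2 exp_size2 ind2 _] := hS.
(* Gaps and sizes have the same exponential laws in both systems; the policy affects only the
   remaining sizes. *)
have marginal j B : measurable B ->
    P1 (primitives S_IF j @^-1` B) = P2 (primitives S_pi j @^-1` B).
  move=> mB; case: j => -[c n].
  - exact: etrans (exp_gap1 c n B mB) (esym (exp_gap2 c n B mB)).
  - exact: etrans (exp_size1 c n B mB) (esym (exp_size2 c n B mB)).
have same_law := independent_same_law ind1 ind2 marginal.
split=> x.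
- have [_ le1] := IF_event_IF hk lambda_gt0 x ht hIF.
  have [_ le2] := IF_event_class_P lambda_gt0 x ht hS hpi.
  (* The event depends on the primitives alone, so its probability carries over from [P1] to
     [P2]. *)
  apply: le_trans le1 (le_trans _ le2).
  by rewrite same_law//; exact: measurable_IF_event.
- have [le1 _] := IF_event_IF hk lambda_gt0 x ht hIF.
  have [le2 _] := IF_event_class_P lambda_gt0 x ht hS hpi.
  apply: le_trans le1 (le_trans _ le2).
  by rewrite same_law//; exact: measurable_IF_inelastic_event.
Qed.
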